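(* For a greedy policy and an alternating policy applied to the same label sequences, with match counts $M_{\mathbf G}(n)$ and $M_{\mathbf A}(n)$ respectively, $$\lim_{n\to\infty}\frac{\mathbb E\bigl(M_{\mathbf G}(n)-M_{\mathbf A}(n)\bigr)}{n}=\frac{\sigma_{\mathbf R}^2+\sigma_{\mathbf S}^2}{8\mu}.$$
   Context: Let $(r_i)_{i\ge1}$, $(s_i)_{i\ge1}$ be probability vectors on the positive integers with $\mu:=\sum_i r_is_i>0$. Let $\{L_{\mathbf R}(n)\}_{n\ge1}$, $\{L_{\mathbf S}(n)\}_{n\ge1}$ be independent i.i.d. sequences with $\Pr(L_{\mathbf R}(1)=i)=r_i$, $\Pr(L_{\mathbf S}(1)=i)=s_i$. For $m\ge0$ let $\tilde N_{\mathbf R}(m)$ be the vector with entries $N_{\mathbf R}(m,i)=\sum_{j=1}^m\mathbf 1\{L_{\mathbf R}(j)=i\}$, and $\tilde N_{\mathbf S}(m)$ analogously. Put $X_{\mathbf R}(n)=s_{L_{\mathbf R}(n)}$, $X_{\mathbf S}(n)=r_{L_{\mathbf S}(n)}$ (common mean $\mu$, variances $\sigma_{\mathbf R}^2,\sigma_{\mathbf S}^2$; standing assumption $\sigma_{\mathbf R}+\sigma_{\mathbf S}>0$), $\Gamma_{\mathbf R}[m]=\sum_{j=1}^mX_{\mathbf R}(j)$, $\Gamma_{\mathbf S}[m]=\sum_{j=1}^mX_{\mathbf S}(j)$. A reading policy is a $\{0,1\}$-valued process $C(n)$ ($C(n)=1$ iff the $n$-th record is read from $\mathbf R$), $R(n)=\sum_{j\le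 n}C(j)$, $S(n)=n-R(n)$, with $C(n)$ being $\mathcal F_{n-1}$-measurable where $\mathcal F_n=\mathcal F_0\vee\sigma(L_{\mathbf R}(1),\dots,L_{\mathbf R}(R(n));L_{\mathbf S}(1),\dots,L_{\mathbf S}(S(n)))$ and $\mathcal F_0$ (randomization, for both policies) is independent of the labels. Matches: $M(n)=\tilde N_{\mathbf R}(R(n))\cdot\tilde N_{\mathbf S}(S(n))$. An alternating policy is $\mathcal F_0$-measurable with $R(2n)=n$ for all $n$. A greedy policy satisfies, for $n\ge1$, $C(n+1)=1$ if $\Gamma_{\mathbf S}[S(n)]>\Gamma_{\mathbf R}[R(n)]$ and $C(n+1)=0$ if $\Gamma_{\mathbf S}[S(n)]<\Gamma_{\mathbf R}[R(n)]$ (ties arbitrary). *)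

(* Defs.v *)
From HB Require Import structures.
From mathcomp Require Import all_boot all_order all_algebra.
From mathcomp Require Import all_classical all_reals all_analysis.
Set Implicit Arguments. Unset Strict Implicit. Unset Printing Implicit Defensive.
Import Order.TTheory GRing.Theory Num.Theory numFieldNormedType.Exports.
Local Open Scope classical_set_scope.
Local Open Scope ring_scope.

(* Labels are given as sequences [L : nat -> Omega -> nat]; only the indices
   j >= 1 are used (L 1, L 2, ...), index 0 is ignored, as in the paper. *)

Definition hist (Omega : Type) (L : nat -> Omega -> nat) (m : nat) (w : Omega)
  : seq nat := [seq L j w | j <- iota 1 m].

(* A reading policy with randomization variable U : Omega -> T (generating F_0)
   is given by decision functions phi: C(n+1) = phi n (U w) (history of R read so
   far) (history of S read so far).  This is exactly F_n-measurability of C(n+1)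
   (Doob-Dynkin), the histories ranging over a countable set.
   [Rcount] computes R(n) = sum_{j<=n} C(j). *)
Fixpoint Rcount (Omega T : Type) (phi : nat -> T -> seq nat -> seq nat -> bool)
  (U : Omega -> T) (LR LS : nat -> Omega -> nat) (n : nat) (w : Omega) : nat :=
  match n with
  | 0 => 0
  | n'.+1 =>
      let r := Rcount phi U LR LS n' w in
      r + phi n' (U w) (hist LR r w) (hist LS (n' - r) w)
  end.

Definition Cread (Omega T : Type) (phi : nat -> T -> seq nat -> seq nat -> bool)
  (U : Omega -> T) (LR LS : nat -> Omega -> nat) (n : nat) (w : Omega) : bool :=
  phi n.-1 (U w) (hist LR (Rcount phi U LR LS n.-1 w) w)
                 (hist LS (n.-1 - Rcount phi U LR LS n.-1 w) w).

Definition Ncount (Omega : Type) (L : nat -> Omega -> nat) (m i : nat) (w : Omega)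
  : nat := count (pred1 i) (hist L m w).

(* dot product  N_R(a) . N_S(b) ; the vectors vanish at every index larger
   than all labels read, so the sum over i <= max label is the full sum. *)
Definition dotN (Omega : Type) (LR LS : nat -> Omega -> nat) (a b : nat)
  (w : Omega) : nat :=
  \sum_(0 <= i < (\max_(x <- hist LR a w ++ hist LS b w) x).+1)
     Ncount LR a i w * Ncount LS b i w.

Definition Matches (Omega T : Type) (phi : nat -> T -> seq nat -> seq nat -> bool)
  (U : Omega -> T) (LR LS : nat -> Omega -> nat) (n : nat) (w : Omega) : nat :=
  dotN LR LS (Rcount phi U LR LS n w) (n - Rcount phi U LR LS n w) w.

(* Gamma_R[m] = sum_{j<=m} s_{L_R(j)},  Gamma_S[m] = sum_{j<=m} r_{L_S(j)} *)
Definition Gamma (R : realType) (Omega : Type) (L : nat -> Omega -> nat)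
  (q : nat -> R) (m : nat) (w : Omega) : R :=
  \sum_(1 <= j < m.+1) q (L j w).

Definition sums_to (R : realType) (f : nat -> R) (l : R) : Prop :=
  (fun n => \sum_(0 <= i < n) f i) @ \oo --> l.

(* Main.v *)
(* Write A and B for the scores Gamma_R[R(n)] and Gamma_S[S(n)], p and q for the
   numbers of records read from R and S, and M for the number of matches. For
   any reading policy the processes mu M - A B,
   Z_e = (A - mu p) + e (B - mu q) and Z_e^2 - sigR2 p - sigS2 q, for e = 1, -1,
   are martingales: as functions of the two histories they are harmonic for
   both moves (reading from R, reading from S), so the policy does not matter.
   Combined with p + q = n and 4 A B = (A + B)^2 - (A - B)^2 they give
     4 mu E M = mu^2 n^2 + E (sigR2 p + sigS2 q - (A - B)^2).
   Under the greedy policy |A - B| <= 1, hence E p and E q are n/2 + O(1) and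
   4 mu E M = mu^2 n^2 + (sigR2 + sigS2) n / 2 + O(1). Under the alternating
   policy |p - q| <= 1, hence A - B differs by O(1) from Z_(-1), whose second
   moment is E (sigR2 p + sigS2 q), and 4 mu E M = mu^2 n^2 + O(sqrt n). *)

Require Import Defs.
From HB Require Import structures.
From mathcomp Require Import all_boot all_order all_algebra.
From mathcomp Require Import all_classical all_reals all_analysis.
From mathcomp Require Import measurable_realfun ring lra zify.
Set Implicit Arguments. Unset Strict Implicit. Unset Printing Implicit Defensive.
Import Order.TTheory GRing.Theory Num.Theory numFieldNormedType.Exports.
Local Open Scope classical_set_scope.
Local Open Scope ring_scope.

(** * Random variables with countably many values *)

Definition discrete_rv {d : measure_display} {Omega : measurableType d}
  {S : countType} (X : Omega -> S) :=
  forall t, measurable [set w | X w = t].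

Lemma discrete_rv_preimage {d : measure_display} {Omega : measurableType d}
    {S : countType} {X : Omega -> S} (A : set S) :
  discrete_rv X -> measurable (X @^-1` A).
Proof.
move=> mX.
have -> : X @^-1` A = \bigcup_(t in A) [set w | X w = t].
  by apply/seteqP; split => [w Aw|w [t At] /= ->//]; exists (X w).
rewrite bigcup_mkcond; apply: countable_bigcupT_measurable => // t.
by case: ifP.
Qed.

Lemma discrete_rv_measurable {d : measure_display} {Omega : measurableType d}
    {S : countType} {X : Omega -> S} {d' : measure_display}
    {V : measurableType d'} (f : S -> V) :
  discrete_rv X -> measurable_fun setT (fun w => f (X w)).
Proof.
by move=> mX _ B mB; rewrite setTI; exact: (discrete_rv_preimage (f @^-1` B)).
Qed.

Lemma discrete_rv_comp {d : measure_display} {Omega : measurableType d}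
    {S V : countType} {X : Omega -> S} (f : S -> V) :
  discrete_rv X -> discrete_rv (fun w => f (X w)).
Proof. by move=> mX v; exact: (discrete_rv_preimage [set t | f t = v]). Qed.

Lemma discrete_rv_pair {d : measure_display} {Omega : measurableType d}
    {S V : countType} {X : Omega -> S} {Y : Omega -> V} :
  discrete_rv X -> discrete_rv Y -> discrete_rv (fun w => (X w, Y w)).
Proof.
move=> mX mY [t v].
have -> : [set w | (X w, Y w) = (t, v)] =
    [set w | X w = t] `&` [set w | Y w = v].
  by apply/seteqP; split => w /= [-> ->].
exact: measurableI.
Qed.

(** Countable additivity over the fibres of [X]. They are indexed by [pickle] codes so that the sum
    is a series over [nat]; codes that are not attained give empty pieces. *)
Lemma ge0_integral_discrete_rv {R : realType} {d : measure_display}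
    {Omega : measurableType d} (P : probability Omega R) {S : countType}
    {X : Omega -> S} {D : set Omega} {f : Omega -> \bar R} :
  discrete_rv X -> measurable D -> measurable_fun setT f ->
  (forall w, 0 <= f w)%E ->
  (\int[P]_(w in D) f w =
   \sum_(0 <= k <oo) \int[P]_(w in D `&` [set w | pickle (X w) = k]) f w)%E.
Proof.
move=> mX mD mf f0.
have DE : D = \bigcup_k (D `&` [set w | pickle (X w) = k]).
  by apply/seteqP; split => [w Dw|w [k _ []//]]; exists (pickle (X w)).
rewrite [in LHS]DE ge0_integral_bigcup//.
- by move=> k; apply: measurableI => //; exact: discrete_rv_comp.
- by rewrite -DE; exact: measurable_funTS.
- apply/trivIsetP => i j _ _ /eqP ij; rewrite -subset0 => w /=.
  by move=> [[_ iX] [_ jX]]; apply: ij; rewrite -iX.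
Qed.

(** Given [X = t], the label [L] has law [q t]; averaging it out replaces [g] by its conditional
    mean [G]. Nonnegativity allows the integral to be split along [X] and then along [L]. *)
Lemma ge0_integral_independent_label {R : realType} {d : measure_display}
    {Omega : measurableType d} (P : probability Omega R) {S : countType}
    (X : Omega -> S) (L : Omega -> nat) (q g : S -> nat -> R) (G : S -> R) :
  discrete_rv X -> discrete_rv L ->
  (forall t i, P ([set w | X w = t] `&` [set w | L w = i]) =
    P [set w | X w = t] * (q t i)%:E)%E ->
  (forall t i, 0 <= q t i) ->
  (forall w i, 0 <= g (X w) i) ->
  (forall w, sums_to (fun i => q (X w) i * g (X w) i) (G (X w))) ->
  (\int[P]_w (g (X w) (L w))%:E = \int[P]_w (G (X w))%:E)%E.
Proof.
move=> mX mL PXL q0 g0 gG.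
have G0 w : 0 <= G (X w).
  have /cvg_lim <- // := gG w.
  apply: limr_ge; first by apply/cvg_ex; exists (G (X w)); exact: gG.
  by near=> n; apply: sumr_ge0 => i _; rewrite mulr_ge0.
have mg : measurable_fun setT (fun w => (g (X w) (L w))%:E).
  apply/measurable_EFinP.
  exact: (discrete_rv_measurable (fun p => g p.1 p.2) (discrete_rv_pair mX mL)).
rewrite !(ge0_integral_discrete_rv P mX)//; last 2 first.
- by apply/measurable_EFinP; exact: discrete_rv_measurable.
- by move=> w; rewrite lee_fin.
apply: eq_eseriesr => k _; rewrite setTI.
(* Either the code [k] is not attained and both integrals vanish, or the fibre is the event [X = t]
   for an attained value [t]. *)
have [->|/set0P[w0 /= <-]] := eqVneq [set w | pickle (X w) = k] set0.
  by rewrite !integral_set0.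
set t := X w0.
have -> : [set w | pickle (X w) = pickle t] = [set w | X w = t].
  by apply/seteqP; split => [w /= /(pcan_inj pickleK)|w /= ->].
rewrite (ge0_integral_discrete_rv P mL)//; last by move=> w; rewrite lee_fin.
have Pt : P [set w | X w = t] = (fine (P [set w | X w = t]))%:E.
  by rewrite fineK// fin_num_measure.
move: (fine _) Pt => p Pt.
transitivity (\sum_(0 <= i <oo) p%:E * (q t i * g t i)%:E)%E.
  apply: eq_eseriesr => i _.
  transitivity (\int[P]_(w in [set w | X w = t] `&` [set w | L w = i])
      (cst (g t i)%:E w))%E.
    rewrite [in LHS](_ : [set w | pickle (L w) = i] = [set w | L w = i])//.
    by apply: eq_integral => w; rewrite inE => -[/= -> ->].
  rewrite integral_cst; last exact: measurableI.
  by rewrite EFinM muleA [RHS]muleC -Pt; congr (_ * _)%E; exact: PXL.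
have -> : (\int[P]_(w in [set w | X w = t]) (G (X w))%:E =
    p%:E * (G t)%:E)%E.
  transitivity (\int[P]_(w in [set w | X w = t]) (cst (G t)%:E w))%E.
    by apply: eq_integral => w; rewrite inE => /= ->.
  by rewrite integral_cst// muleC -Pt.
rewrite nneseriesZl; last by move=> i _; rewrite lee_fin mulr_ge0//; exact: g0.
congr (_ * _)%E; apply/cvg_lim => //.
under eq_fun do rewrite sumEFin.
by apply: cvg_EFin; [exact: nearW|exact: gG].
Unshelve. all: by end_near. Qed.

(** The history read by time [n] has a random length; splitting over the countably many lengths
    makes it measurable. *)
Lemma discrete_rv_random_index {d : measure_display} {Omega : measurableType d}
    {S V : countType} {X : Omega -> S} {F : S -> Omega -> V} :
  discrete_rv X -> (forall t, discrete_rv (F t)) ->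
  discrete_rv (fun w => F (X w) w).
Proof.
move=> mX mF v.
have -> : [set w | F (X w) w = v] =
    \bigcup_t ([set w | X w = t] `&` [set w | F t w = v]).
  apply/seteqP; split => w /=; last by move=> [t _ [/= -> ->]].
  by move=> Fw; exists (X w).
apply: countable_bigcupT_measurable => // t.
by apply: measurableI; [exact: mX|exact: mF].
Qed.

(** * Label histories *)

Lemma size_hist {Omega : Type} (L : nat -> Omega -> nat) m w :
  size (hist L m w) = m.
Proof. by rewrite size_map size_iota. Qed.

Lemma histS {Omega : Type} (L : nat -> Omega -> nat) m w :
  hist L m.+1 w = rcons (hist L m w) (L m.+1 w).
Proof. by rewrite /hist -[in LHS](addn1 m) iotaD map_cat cats1 add1n. Qed.

Lemma take_hist {Omega : Type} (L : nat -> Omega -> nat) k m w :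
  (k <= m)%N -> take k (hist L m w) = hist L k w.
Proof. by move=> km; rewrite -map_take take_iota (minn_idPl km). Qed.

Lemma hist_prefix {Omega Omega' : Type} (L : nat -> Omega -> nat)
    (L' : nat -> Omega' -> nat) k m w w' :
  (k <= m)%N -> hist L m w = hist L' m w' -> hist L k w = hist L' k w'.
Proof. by move=> km LL'; rewrite -(take_hist L w km) LL' take_hist. Qed.

(** A deterministic label sequence that replays [a], used to run a policy on fixed histories. Labels
    are numbered from 1, hence the shift [j.-1]. *)
Lemma hist_nth {Omega : Type} (a : seq nat) (w : Omega) :
  hist (fun j _ => nth 0%N a j.-1) (size a) w = a.
Proof.
rewrite -[RHS](mkseq_nth 0%N) /mkseq /hist -[1%N]/(1 + 0)%N iotaDl -map_comp.
exact: eq_map.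
Qed.

Lemma discrete_rv_hist {d : measure_display} {Omega : measurableType d}
    {L : nat -> Omega -> nat} :
  (forall j, discrete_rv (L j)) -> forall m, discrete_rv (hist L m).
Proof.
move=> mL; elim=> [|m IHm].
  exact: (discrete_rv_comp (fun=> [::]) (mL 0%N)).
rewrite (_ : hist L m.+1 = fun w => rcons (hist L m w) (L m.+1 w)); last first.
  by apply/funext => w; exact: histS.
exact: (discrete_rv_comp (fun p => rcons p.1 p.2) (discrete_rv_pair IHm (mL _))).
Qed.

(** * State of a policy after [n] readings *)

Section policy_state.
Context {Omega T : Type}.
Implicit Types (phi : nat -> T -> seq nat -> seq nat -> bool) (U : Omega -> T)
  (LR LS : nat -> Omega -> nat).

Definition R_hist phi U LR LS n w := hist LR (Rcount phi U LR LS n w) w.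

Definition S_hist phi U LR LS n w := hist LS (n - Rcount phi U LR LS n w) w.

(** This is C(n+1): the choice is indexed by the number of records already read. *)
Definition decision phi U LR LS n w :=
  phi n (U w) (R_hist phi U LR LS n w) (S_hist phi U LR LS n w).

Definition next_label phi U LR LS n w :=
  if decision phi U LR LS n w then LR (Rcount phi U LR LS n w).+1 w
  else LS (n - Rcount phi U LR LS n w).+1 w.

Definition at_time phi U LR LS {V : Type} (f : seq nat -> seq nat -> V) n w :=
  f (R_hist phi U LR LS n w) (S_hist phi U LR LS n w).

Lemma RcountS phi U LR LS n w : Rcount phi U LR LS n.+1 w =
  (Rcount phi U LR LS n w + decision phi U LR LS n w)%N.
Proof. by []. Qed.

Lemma Rcount_le phi U LR LS n w : (Rcount phi U LR LS n w <= n)%N.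
Proof.
elim: n => // n IHn; rewrite RcountS.
by case: decision; rewrite ?addn1 ?ltnS// addn0 leqW.
Qed.

Lemma size_histsD phi U LR LS n w :
  (size (R_hist phi U LR LS n w) + size (S_hist phi U LR LS n w))%N = n.
Proof. by rewrite !size_hist subnKC// Rcount_le. Qed.

Lemma R_histS phi U LR LS n w : R_hist phi U LR LS n.+1 w =
  if decision phi U LR LS n w
  then rcons (R_hist phi U LR LS n w) (next_label phi U LR LS n w)
  else R_hist phi U LR LS n w.
Proof.
rewrite /next_label /R_hist RcountS.
by case: decision; rewrite ?addn0// addn1 histS.
Qed.

Lemma S_histS phi U LR LS n w : S_hist phi U LR LS n.+1 w =
  if decision phi U LR LS n w then S_hist phi U LR LS n w
  else rcons (S_hist phi U LR LS n w) (next_label phi U LR LS n w).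
Proof.
rewrite /next_label /S_hist RcountS.
case: decision; first by rewrite addn1 subSS.
by rewrite addn0 subSn ?Rcount_le// histS.
Qed.

End policy_state.

(** The run up to time [n] sees only the randomization and prefixes of the two histories. The two
    runs may live on different sample spaces, so that one of them can use frozen label sequences. *)
Lemma Rcount_local {Omega Omega' T : Type}
    (phi : nat -> T -> seq nat -> seq nat -> bool)
    (U : Omega -> T) (LR LS : nat -> Omega -> nat) (w : Omega)
    (U' : Omega' -> T) (LR' LS' : nat -> Omega' -> nat) (w' : Omega') n :
  let m := Rcount phi U LR LS n w in
  U w = U' w' ->
  hist LR m w = hist LR' m w' -> hist LS (n - m) w = hist LS' (n - m) w' ->
  Rcount phi U' LR' LS' n w' = m.
Proof.
elim: n => //= n IHn UU'; set m := Rcount phi U LR LS n w in IHn *.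
set c := phi _ _ _ _ => eR eS.
have mn : (m <= n)%N by exact: Rcount_le.
have {}eR : hist LR m w = hist LR' m w'.
  by apply: hist_prefix eR; rewrite leq_addr.
have {}eS : hist LS (n - m) w = hist LS' (n - m) w'.
  by apply: hist_prefix eS; rewrite leq_subLR; case: (c) => /=; lia.
by rewrite IHn// -UU' -eR -eS.
Qed.

(** * Measurability of the policy state *)

Section policy_measurability.
Context {d dT : measure_display} {Omega : measurableType d}
  {T : measurableType dT} {phi : nat -> T -> seq nat -> seq nat -> bool}
  {U : Omega -> T} {LR LS : nat -> Omega -> nat}.
Hypothesis mphi : forall n a b, measurable [set u | phi n u a b].
Hypothesis mU : measurable_fun setT U.
Hypothesis mLR : forall j, discrete_rv (LR j).
Hypothesis mLS : forall j, discrete_rv (LS j).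

Lemma discrete_rv_R_hist_of n : discrete_rv (Rcount phi U LR LS n) ->
  discrete_rv (R_hist phi U LR LS n).
Proof.
by move=> mR; apply: (discrete_rv_random_index mR); exact: discrete_rv_hist.
Qed.

Lemma discrete_rv_S_hist_of n : discrete_rv (Rcount phi U LR LS n) ->
  discrete_rv (S_hist phi U LR LS n).
Proof.
move=> mR; apply: (discrete_rv_random_index (F := fun k => hist LS (n - k)) mR).
by move=> k; exact: discrete_rv_hist.
Qed.

Lemma measurable_decision_eq n a b c : measurable [set u | phi n u a b = c].
Proof.
case: c; first exact: mphi.
rewrite (_ : mkset _ = ~` [set u | phi n u a b]); first exact: measurableC.
by apply/seteqP; split => u /=; [move->|move/negP/negbTE].
Qed.

Lemma discrete_rv_decision_of n : discrete_rv (Rcount phi U LR LS n) ->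
  discrete_rv (decision phi U LR LS n).
Proof.
move=> mR.
have mab := discrete_rv_pair (discrete_rv_R_hist_of mR) (discrete_rv_S_hist_of mR).
apply: (discrete_rv_random_index (F := fun ab w => phi n (U w) ab.1 ab.2) mab).
move=> [a b] c /=; rewrite -[X in measurable X]setTI.
exact: mU measurableT _ (measurable_decision_eq n a b c).
Qed.

Lemma discrete_rv_Rcount n : discrete_rv (Rcount phi U LR LS n).
Proof.
elim: n => [|n IHn]; first exact: (discrete_rv_comp (fun=> 0%N) (mLR 0%N)).
exact: (discrete_rv_comp (fun p : nat * bool => (p.1 + p.2)%N)
  (discrete_rv_pair IHn (discrete_rv_decision_of IHn))).
Qed.

Lemma discrete_rv_R_hist n : discrete_rv (R_hist phi U LR LS n).
Proof. exact/discrete_rv_R_hist_of/discrete_rv_Rcount. Qed.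

Lemma discrete_rv_S_hist n : discrete_rv (S_hist phi U LR LS n).
Proof. exact/discrete_rv_S_hist_of/discrete_rv_Rcount. Qed.

Lemma discrete_rv_decision n : discrete_rv (decision phi U LR LS n).
Proof. exact/discrete_rv_decision_of/discrete_rv_Rcount. Qed.

Lemma discrete_rv_next_label n : discrete_rv (next_label phi U LR LS n).
Proof.
pose F (p : bool * nat) := if p.1 then LR p.2.+1 else LS (n - p.2).+1.
have mF p : discrete_rv (F p) by rewrite /F; case: ifP.
have -> : next_label phi U LR LS n =
    fun w => F (decision phi U LR LS n w, Rcount phi U LR LS n w) w.
  by apply/funext => w; rewrite /next_label /F/=; case: ifP.
have := discrete_rv_pair (discrete_rv_decision n) (discrete_rv_Rcount n).
by move/discrete_rv_random_index; apply.
Qed.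

End policy_measurability.

(** * Conditional law of the next label *)

Section label_law.
Context {R : realType} {d dT : measure_display} {Omega : measurableType d}
  {T : measurableType dT} {P : probability Omega R}
  {phi : nat -> T -> seq nat -> seq nat -> bool}
  {U : Omega -> T} {LR LS : nat -> Omega -> nat} {r s : nat -> R}.
Hypothesis mphi : forall n a b, measurable [set u | phi n u a b].
Hypothesis indep : forall (A : set T), measurable A -> forall (a b : seq nat),
  P (U @^-1` A `&` [set w | hist LR (size a) w = a]
              `&` [set w | hist LS (size b) w = b])
  = (P (U @^-1` A) * (\prod_(x <- a) r x * \prod_(y <- b) s y)%:E)%E.

Let state n w :=
  (decision phi U LR LS n w, (R_hist phi U LR LS n w, S_hist phi U LR LS n w)).

(* The policy is run on the fixed histories [a] and [b]: this determines
   which values of the randomization lead to the state [(a, b)]. *)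
Let leads_to n c (a b : seq nat) : set T :=
  [set u | Rcount phi id (fun j _ => nth 0%N a j.-1) (fun j _ => nth 0%N b j.-1)
             n u = size a] `&` [set u | phi n u a b = c].

Let measurable_leads_to n c a b : measurable (leads_to n c a b).
Proof.
apply: measurableI; last exact: measurable_decision_eq.
have mcst (k : nat) : discrete_rv (fun _ : T => k).
  move=> j; have [kj|kj] := eqVneq k j.
    by rewrite (_ : mkset _ = setT)//; apply/seteqP; split.
  rewrite (_ : mkset _ = set0)// -subset0 => u /= /eqP.
  by rewrite (negbTE kj).
have := discrete_rv_Rcount mphi (@measurable_id _ T setT)
  (fun j => mcst (nth 0%N a j.-1)) (fun j => mcst (nth 0%N b j.-1)) n.
exact.
Qed.

(** By locality of the run, the event is a rectangle: one condition on [U] and one on each label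
    sequence at a fixed length. This is the form to which [indep] applies. *)
Let state_event n c (a b : seq nat) : (size a + size b)%N = n ->
  [set w | state n w = (c, (a, b))] =
  U @^-1` leads_to n c a b `&` [set w | hist LR (size a) w = a]
                           `&` [set w | hist LS (size b) w = b].
Proof.
move=> abn; have nab : (n - size a)%N = size b by rewrite -abn addKn.
apply/seteqP; split => w /=.
  move=> [ec ea eb].
  have Ra : Rcount phi U LR LS n w = size a by rewrite -ea size_hist.
  have ha : hist LR (size a) w = a by rewrite -Ra.
  have hb : hist LS (size b) w = b by rewrite -nab -Ra.
  do 2 split => //; split; last by rewrite -ec /decision ea eb.
  by rewrite /= (@Rcount_local _ _ _ _ U LR LS w)// Ra ?nab ?hist_nth.
move=> [[[rc ec] ha] hb].
have Ra : Rcount phi U LR LS n w = size a.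
  rewrite -[RHS]rc; apply: Rcount_local => //; rewrite rc ?nab hist_nth.
    by rewrite ha.
  by rewrite hb.
have ea : R_hist phi U LR LS n w = a by rewrite /R_hist Ra.
have eb : S_hist phi U LR LS n w = b by rewrite /S_hist Ra nab.
by rewrite /state /decision ea eb ec.
Qed.

(** Appending [i] to the history being extended turns one rectangle into another, and [indep] gives
    the second one the extra factor [r i] or [s i]. *)
Lemma next_label_independent n t i :
  P ([set w | state n w = t] `&` [set w | next_label phi U LR LS n w = i]) =
  (P [set w | state n w = t] * (if t.1 then r i else s i)%:E)%E.
Proof.
case: t => [c [a b]].
(* After [n] readings the two lengths add up to [n]; for any other state both sides vanish. *)
have [abn|abn] := eqVneq (size a + size b)%N n; last first.
  rewrite (_ : [set w | state n w = _] = set0) ?set0I ?measure0 ?mul0e//.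
  rewrite -subset0 => w /= [_ ea eb]; move/eqP: abn; apply.
  by rewrite -ea -eb size_histsD.
rewrite state_event// indep//.
have nextE w : state n w = (c, (a, b)) ->
    next_label phi U LR LS n w =
    if c then LR (size a).+1 w else LS (size b).+1 w.
  by rewrite /next_label => -[-> <- <-]; rewrite !size_hist.
have stateP w : state n w = (c, (a, b)) <->
    [/\ leads_to n c a b (U w), hist LR (size a) w = a & hist LS (size b) w = b].
  rewrite -[_ = _]/([set w | state n w = (c, (a, b))] w) state_event//.
  by split => [[[]]|[]].
case: c => /= in nextE stateP *.
- have := indep (measurable_leads_to n true a b) (rcons a i) b.
  rewrite size_rcons big_rcons/= => e.
  transitivity (P (U @^-1` leads_to n true a b) *
     (\prod_(x <- a) r x * r i * \prod_(y <- b) s y)%:E)%E; last first.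
    by rewrite -muleA -EFinM mulrAC.
  rewrite -e; congr (P _); apply/seteqP; split => w /=.
    move=> [[[Uw ha] hb] li].
    have sw : state n w = (true, (a, b)) by exact/stateP.
    by do 2 split => //; rewrite histS ha -li nextE.
  rewrite histS => -[[Uw /rcons_inj[ha li]] hb].
  have sw : state n w = (true, (a, b)) by exact/stateP.
  by split; [split; [split|]|rewrite nextE].
- have := indep (measurable_leads_to n false a b) a (rcons b i).
  rewrite size_rcons big_rcons/= => e.
  transitivity (P (U @^-1` leads_to n false a b) *
     (\prod_(x <- a) r x * (\prod_(y <- b) s y * s i))%:E)%E; last first.
    by rewrite -muleA -EFinM mulrA.
  rewrite -e; congr (P _); apply/seteqP; split => w /=.
    move=> [[[Uw ha] hb] li].
    have sw : state n w = (false, (a, b)) by exact/stateP.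
    by split => //; rewrite histS hb -li nextE.
  rewrite histS => -[[Uw ha] /rcons_inj[hb li]].
  have sw : state n w = (false, (a, b)) by exact/stateP.
  by split; [split|rewrite nextE].
Qed.

End label_law.

(** * Series with a prescribed sum *)

Section sums_to_theory.
Context {R : realType}.
Implicit Types (f g p x y : nat -> R).

Lemma eq_sums_to f g l : f =1 g -> sums_to f l -> sums_to g l.
Proof. by move/funext->. Qed.

Lemma sums_toD f g l m :
  sums_to f l -> sums_to g m -> sums_to (fun i => f i + g i) (l + m).
Proof.
move=> fl gm; rewrite /sums_to; under eq_fun do rewrite big_split/=.
exact: cvgD.
Qed.

Lemma sums_toZ (c : R) f l : sums_to f l -> sums_to (fun i => c * f i) (c * l).
Proof.
move=> fl; rewrite /sums_to; under eq_fun do rewrite -mulr_sumr.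
exact: cvgMr.
Qed.

(** The value of each harmonic function below after one reading is affine in two quantities attached
    to the drawn label; this computes its mean. *)
Lemma sums_to_affine p x y (e mx my c0 c1 c2 : R) :
  sums_to p e -> sums_to (fun i => p i * x i) mx ->
  sums_to (fun i => p i * y i) my ->
  sums_to (fun i => p i * (c0 + c1 * x i + c2 * y i))
          (c0 * e + c1 * mx + c2 * my).
Proof.
move=> p1 px py.
apply: (eq_sums_to _ (sums_toD (sums_toD (@sums_toZ c0 _ _ p1)
  (@sums_toZ c1 _ _ px)) (@sums_toZ c2 _ _ py))) => i.
by ring.
Qed.

Lemma sums_to_delta f j : sums_to (fun i => f i * (i == j)%:R) (f j).
Proof.
apply: cvg_near_cst; near=> n.
have jn : (j < n)%N by near: n; exact: nbhs_infty_gt.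
rewrite big_mkord (bigD1 (Ordinal jn))//= eqxx mulr1 big1 ?addr0// => i ij.
by rewrite (_ : (i == j :> nat) = false) ?mulr0//; exact: negbTE.
Unshelve. all: by end_near. Qed.

Lemma sums_to0 : sums_to (fun=> 0 : R) 0.
Proof. by apply: cvg_near_cst; apply: nearW => n; rewrite big1. Qed.

(** The mean number of matches that a label drawn from [p] makes with [b] is the score of [b]. *)
Lemma sums_to_count p (b : seq nat) :
  sums_to (fun i => p i * (count_mem i b)%:R) (\sum_(x <- b) p x).
Proof.
elim: b => [|x b IHb].
  by rewrite big_nil; apply: (eq_sums_to _ sums_to0) => i; rewrite mulr0.
rewrite big_cons; apply: (eq_sums_to _ (sums_toD (@sums_to_delta p x) IHb)) => i /=.
by rewrite natrD mulrDr eq_sym.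
Qed.

Lemma ge0_sums_to_le f l i : (forall i, 0 <= f i) -> sums_to f l -> f i <= l.
Proof.
move=> f0 fl.
have nd : nondecreasing_seq (fun n => \sum_(0 <= i < n) f i).
  by apply/nondecreasing_seqP => n; rewrite big_nat_recr//= lerDl.
have := nondecreasing_cvgn_le nd (cvgP _ fl) i.+1.
rewrite (cvg_lim _ fl)//; apply: le_trans.
by rewrite big_nat_recr//= lerDr sumr_ge0.
Qed.

Lemma ge0_sums_to f l : (forall i, 0 <= f i) -> sums_to f l -> 0 <= l.
Proof. by move=> f0 fl; apply: le_trans (f0 0%N) _; exact: ge0_sums_to_le. Qed.

End sums_to_theory.
Arguments sums_toZ {R} c {f l}.
Arguments sums_to_affine {R p x y e mx my} c0 c1 c2.
Arguments sums_to_count {R} p b.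

(** * Functions bounded at each time *)

Section level_bounded.
Context {R : realType}.
Implicit Types (f g : seq nat -> seq nat -> R).

(** A level contains all pairs of histories possible at time [n], so a bound on each level gives
    integrability at each time. *)
Definition level_bounded f := forall n, exists K,
  forall a b, (size a + size b)%N = n -> `|f a b| <= K.

Lemma level_bounded_cst (c : R) : level_bounded (fun _ _ => c).
Proof. by move=> n; exists `|c|. Qed.

Lemma level_boundedD f g : level_bounded f -> level_bounded g ->
  level_bounded (fun a b => f a b + g a b).
Proof.
move=> bf bg n; have [[K fK] [K' gK']] := (bf n, bg n); exists (K + K').
by move=> a b abn; rewrite (le_trans (ler_normD _ _))// lerD ?fK ?gK'.
Qed.

Lemma level_boundedM f g : level_bounded f -> level_bounded g ->
  level_bounded (fun a b => f a b * g a b).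
Proof.
move=> bf bg n; have [[K fK] [K' gK']] := (bf n, bg n); exists (K * K').
by move=> a b abn; rewrite normrM ler_pM ?fK ?gK'.
Qed.

Lemma level_boundedN f : level_bounded f ->
  level_bounded (fun a b => - f a b).
Proof. by move=> bf n; have [K fK] := bf n; exists K => a b /fK; rewrite normrN. Qed.

Lemma level_bounded_sumL (q : nat -> R) : (forall i, 0 <= q i <= 1) ->
  level_bounded (fun a _ => \sum_(x <- a) q x).
Proof.
move=> q01 n; exists n%:R => a b <-; rewrite natrD.
rewrite (le_trans (ler_norm_sum _ _ _))//.
apply: (@le_trans _ _ (size a)%:R); last by rewrite lerDl.
rewrite -sum1_size natr_sum ler_sum// => i _.
by have /andP[? ?] := q01 i; rewrite ger0_norm.
Qed.

Lemma level_boundedC f : level_bounded f -> level_bounded (fun a b => f b a).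
Proof. by move=> bf n; have [K fK] := bf n; exists K => a b; rewrite addnC => /fK. Qed.

Lemma level_bounded_sizeL : level_bounded (fun a _ => (size a)%:R).
Proof.
rewrite (_ : (fun a _ => _) = fun (a _ : seq nat) => \sum_(x <- a) (1 : R)).
  by apply: (@level_bounded_sumL (fun=> 1)) => _; rewrite ler01 lexx.
by apply/funext => a; apply/funext => b; rewrite -sum1_size natr_sum.
Qed.

End level_bounded.

(** * The match count on histories *)

Definition matches (a b : seq nat) : nat := \sum_(x <- a) count_mem x b.

Lemma matches_rconsL a b i : matches (rcons a i) b = (matches a b + count_mem i b)%N.
Proof. by rewrite /matches big_rcons. Qed.

Lemma matches_rconsR a b i : matches a (rcons b i) = (matches a b + count_mem i a)%N.
Proof.
rewrite /matches -sum1_count [X in (_ + X)%N]big_mkcond -big_split/=; apply: eq_bigr => x _.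
by rewrite -cats1 count_cat /= addn0 eq_sym; case: eqVneq.
Qed.

Lemma level_bounded_matches {R : realType} :
  level_bounded (fun a b => (matches a b)%:R : R).
Proof.
move=> n; exists (n * n)%:R => a b <-; rewrite ger0_norm// ler_nat.
apply: (@leq_trans (size a * size b)); last by rewrite leq_mul ?leq_addr ?leq_addl.
rewrite /matches -[X in (_ <= X * _)%N]sum1_size big_distrl/=.
by apply: leq_sum => x _; rewrite mul1n count_size.
Qed.

(** Both sides count pairs of equal labels, grouped by value in [dotN] and by element of the first
    history in [matches]. *)
Lemma dotN_matches {Omega : Type} (LR LS : nat -> Omega -> nat) m k w :
  dotN LR LS m k w = matches (hist LR m w) (hist LS k w).
Proof.
rewrite /dotN /Ncount; set a := hist LR m w; set b := hist LS k w.
set K := (\max_(x <- a ++ b) x).+1.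
have : {in a, forall x, x < K}%N.
  by move=> x xa; rewrite ltnS leq_bigmax_seq// mem_cat xa.
(* Any [K] above the labels of [a] gives the full sum; generalizing it lets the induction keep [K]
   while [a] shrinks. *)
elim: a {K} (K) => [|x a IHa] K aK.
  by rewrite /matches big_nil big1// => i _.
rewrite /matches big_cons -/(matches a b) -(IHa K); last first.
  by move=> y ya; rewrite aK// inE ya orbT.
under eq_bigr do rewrite /= mulnDl.
rewrite big_split/=; congr addn; rewrite big_mkord.
have xK : (x < K)%N by rewrite aK ?mem_head.
rewrite (bigD1 (Ordinal xK))//= eqxx mul1n big1 ?addn0// => i ix.
by rewrite eq_sym (_ : (i == x :> nat) = false)//; exact: negbTE.
Qed.

(** * Harmonic functions of two histories *)

Section harmonic.
Context {R : realType} (r s : nat -> R).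
Implicit Types (f g : seq nat -> seq nat -> R).

Definition is_harmonic f := forall a b,
  sums_to (fun i => r i * f (rcons a i) b) (f a b) /\
  sums_to (fun i => s i * f a (rcons b i)) (f a b).

(** The value 0 at the empty histories becomes the mean at every time. *)
Definition centred_harmonic f :=
  [/\ f [::] [::] = 0, level_bounded f & is_harmonic f].

Lemma centred_harmonicD f g : centred_harmonic f -> centred_harmonic g ->
  centred_harmonic (fun a b => f a b + g a b).
Proof.
move=> [f0 bf hf] [g0 bg hg]; split; first by rewrite f0 g0 addr0.
  exact: level_boundedD.
move=> a b; have [[f1 f2] [g1 g2]] := (hf a b, hg a b); split.
  by apply: (eq_sums_to _ (sums_toD f1 g1)) => i; rewrite mulrDr.
by apply: (eq_sums_to _ (sums_toD f2 g2)) => i; rewrite mulrDr.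
Qed.

Lemma centred_harmonicZ (c : R) f : centred_harmonic f ->
  centred_harmonic (fun a b => c * f a b).
Proof.
move=> [f0 bf hf]; split; first by rewrite f0 mulr0.
  by apply: level_boundedM => //; exact: level_bounded_cst.
move=> a b; have [f1 f2] := hf a b; split.
  by apply: (eq_sums_to _ (sums_toZ c f1)) => i; rewrite mulrCA.
by apply: (eq_sums_to _ (sums_toZ c f2)) => i; rewrite mulrCA.
Qed.

Context (mu sigR2 sigS2 : R).
Hypothesis r01 : forall i, 0 <= r i <= 1.
Hypothesis s01 : forall i, 0 <= s i <= 1.
Hypothesis r1 : sums_to r 1.
Hypothesis s1 : sums_to s 1.
Hypothesis rsmu : sums_to (fun i => r i * s i) mu.
Hypothesis rsig : sums_to (fun i => r i * (s i - mu) ^+ 2) sigR2.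
Hypothesis ssig : sums_to (fun i => s i * (r i - mu) ^+ 2) sigS2.

Definition score (q : nat -> R) (a : seq nat) : R := \sum_(x <- a) q x.

Lemma score_rcons q a i : score q (rcons a i) = score q a + q i.
Proof. by rewrite /score big_rcons. Qed.

Let srmu : sums_to (fun i => s i * r i) mu.
Proof. by apply: (eq_sums_to _ rsmu) => i; rewrite mulrC. Qed.

Lemma level_bounded_scoreL : level_bounded (fun a _ => score s a).
Proof. exact: level_bounded_sumL. Qed.

Lemma level_bounded_scoreR : level_bounded (fun _ b => score r b).
Proof. exact/(level_boundedC (f := fun a _ => score r a))/level_bounded_sumL. Qed.

Let level_bounded_sizeR : level_bounded (fun _ b => (size b)%:R : R).
Proof. exact/(level_boundedC (f := fun a _ => (size a)%:R))/level_bounded_sizeL. Qed.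

(** A label [i] read from R changes the function by [mu * count_mem i b - s i * score r b], and both
    terms have mean [mu * score r b]. The other move is symmetric. *)
Lemma centred_harmonic_matches : centred_harmonic (fun a b =>
  mu * (matches a b)%:R - score s a * score r b).
Proof.
split.
- by rewrite /matches /score !big_nil mulr0 mul0r subr0.
- apply: level_boundedD; first apply: level_boundedM.
  + exact: level_bounded_cst.
  + exact: level_bounded_matches.
  + apply: level_boundedN.
    exact: level_boundedM level_bounded_scoreL level_bounded_scoreR.
- move=> a b; split.
  + have := sums_to_affine (mu * (matches a b)%:R - score s a * score r b)
      (- score r b) mu r1 rsmu (sums_to_count r b).
    rewrite mulr1 mulNr [mu * \sum_(_ <- _) _]mulrC subrK.
    apply: eq_sums_to => i; rewrite matches_rconsL score_rcons natrD.
    by congr (_ * _); ring.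
  + have := sums_to_affine (mu * (matches a b)%:R - score s a * score r b)
      (- score s a) mu s1 srmu (sums_to_count s a).
    rewrite mulr1 mulNr [mu * \sum_(_ <- _) _]mulrC subrK.
    apply: eq_sums_to => i; rewrite matches_rconsR score_rcons natrD.
    by congr (_ * _); ring.
Qed.

(* [e] is a sign: [e = 1] gives the sum of the two scores, [e = -1] their
   difference. *)
Definition centred_score (e : R) (a b : seq nat) : R :=
  (score s a - mu * (size a)%:R) + e * (score r b - mu * (size b)%:R).

Lemma centred_score_rconsL e a b i :
  centred_score e (rcons a i) b = centred_score e a b + (s i - mu).
Proof. by rewrite /centred_score score_rcons size_rcons -[_.+1]addn1 natrD; ring. Qed.

Lemma centred_score_rconsR e a b i :
  centred_score e a (rcons b i) = centred_score e a b + e * (r i - mu).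
Proof. by rewrite /centred_score score_rcons size_rcons -[_.+1]addn1 natrD; ring. Qed.

Lemma centred_score_nil e : centred_score e [::] [::] = 0.
Proof. by rewrite /centred_score /score !big_nil !mulr0 subr0 mulr0 addr0. Qed.

Lemma level_bounded_centred_score e : level_bounded (centred_score e).
Proof.
apply: level_boundedD; first apply: level_boundedD.
- exact: level_bounded_scoreL.
- apply: level_boundedN; apply: level_boundedM; first exact: level_bounded_cst.
  exact: level_bounded_sizeL.
- apply: level_boundedM; first exact: level_bounded_cst.
  apply: level_boundedD; first exact: level_bounded_scoreR.
  apply: level_boundedN; apply: level_boundedM; first exact: level_bounded_cst.
  exact: level_bounded_sizeR.
Qed.

Lemma centred_harmonic_score e : centred_harmonic (centred_score e).
Proof.
split; [exact: centred_score_nil|exact: level_bounded_centred_score|].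
move=> a b; split.
- have := sums_to_affine (centred_score e a b - mu) 1 0 r1 rsmu rsig.
  rewrite !mulr1 mul0r addr0 mul1r subrK.
  by apply: eq_sums_to => i; rewrite centred_score_rconsL; congr (_ * _); ring.
- have := sums_to_affine (centred_score e a b - e * mu) e 0 s1 srmu ssig.
  rewrite !mulr1 mul0r addr0 subrK.
  by apply: eq_sums_to => i; rewrite centred_score_rconsR; congr (_ * _); ring.
Qed.

(** One reading adds to the centred score a centred variable of variance [sigR2] or
    [e ^+ 2 * sigS2]; the subtracted term accumulates these variances. *)
Lemma centred_harmonic_score_sqr e : e ^+ 2 = 1 ->
  centred_harmonic (fun a b => centred_score e a b ^+ 2
    - (sigR2 * (size a)%:R + sigS2 * (size b)%:R)).
Proof.
move=> e1; split.
- by rewrite centred_score_nil !mulr0 addr0 subr0 expr0n.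
- have bc := level_bounded_centred_score e.
  apply: level_boundedD; first exact: (level_boundedM bc bc).
  apply: level_boundedN; apply: level_boundedD.
    apply: level_boundedM; first exact: level_bounded_cst.
    exact: level_bounded_sizeL.
  by apply: level_boundedM; first exact: level_bounded_cst.
- move=> a b; set z := centred_score e a b.
  set v := sigR2 * _ + _; split.
  (* The coefficients come from expanding [(z + (s i - mu)) ^+ 2], less the [sigR2] by which [v]
     grows. *)
  + have := sums_to_affine (z ^+ 2 - 2 * z * mu - v - sigR2) (2 * z) 1
      r1 rsmu rsig.
    rewrite mulr1 mul1r.
    rewrite [X in sums_to _ X](_ : _ = z ^+ 2 - v); last by ring.
    apply: eq_sums_to => i.
    rewrite centred_score_rconsL -/z size_rcons -[_.+1]addn1 natrD /v.
    by congr (_ * _); ring.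
  + have := sums_to_affine (z ^+ 2 - 2 * z * e * mu - v - sigS2) (2 * z * e) 1
      s1 srmu ssig.
    rewrite mulr1 mul1r.
    rewrite [X in sums_to _ X](_ : _ = z ^+ 2 - v); last by ring.
    apply: eq_sums_to => i.
    rewrite centred_score_rconsR -/z size_rcons -[_.+1]addn1 natrD /v.
    rewrite [(z + _) ^+ 2]sqrrD exprMn e1 mul1r.
    by congr (_ * _); ring.
Qed.

End harmonic.

(** * Expectations along a policy *)

Section mean_at.
Context {R : realType} {d dT : measure_display} {Omega : measurableType d}
  {T : measurableType dT} {P : probability Omega R}
  {phi : nat -> T -> seq nat -> seq nat -> bool}
  {U : Omega -> T} {LR LS : nat -> Omega -> nat} {r s : nat -> R}.
Hypothesis mphi : forall n a b, measurable [set u | phi n u a b].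
Hypothesis mU : measurable_fun setT U.
Hypothesis mLR : forall j, discrete_rv (LR j).
Hypothesis mLS : forall j, discrete_rv (LS j).
Hypothesis indep : forall (A : set T), measurable A -> forall (a b : seq nat),
  P (U @^-1` A `&` [set w | hist LR (size a) w = a]
              `&` [set w | hist LS (size b) w = b])
  = (P (U @^-1` A) * (\prod_(x <- a) r x * \prod_(y <- b) s y)%:E)%E.
Hypothesis r0 : forall i, 0 <= r i.
Hypothesis s0 : forall i, 0 <= s i.
Hypothesis r1 : sums_to r 1.
Hypothesis s1 : sums_to s 1.
Implicit Types (f g h : seq nat -> seq nat -> R).

Definition mean_at f n : R := \int[P]_w at_time phi U LR LS f n w.

Lemma integrable_at_time f n : level_bounded f ->
  P.-integrable setT (EFin \o at_time phi U LR LS f n).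
Proof.
move=> bf; apply: measurable_bounded_integrable => //.
- exact: (eq_ind_r (fun x => x < +oo)%E (ltry 1) (probability_setT P)).
- exact: (discrete_rv_measurable (fun ab : seq nat * seq nat => f ab.1 ab.2)
    (discrete_rv_pair (discrete_rv_R_hist mphi mU mLR mLS n)
                      (discrete_rv_S_hist mphi mU mLR mLS n))).
- have [K fK] := bf n; exists K; split; first exact: num_real.
  by move=> x Kx w _ /=; rewrite (le_trans _ (ltW Kx))// fK// size_histsD.
Qed.

Lemma mean_atD f g n : level_bounded f -> level_bounded g ->
  mean_at (fun a b => f a b + g a b) n = mean_at f n + mean_at g n.
Proof. by move=> bf bg; rewrite -RintegralD//; exact: integrable_at_time. Qed.

Lemma mean_atZ (c : R) f n : level_bounded f ->
  mean_at (fun a b => c * f a b) n = c * mean_at f n.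
Proof. by move=> bf; rewrite -RintegralZl//; exact: integrable_at_time. Qed.

Lemma mean_at_cst (c : R) n : mean_at (fun _ _ => c) n = c.
Proof.
transitivity (c * fine (P setT)); first exact: Rintegral_cst.
have -> : fine (P setT) = 1 := congr1 fine (probability_setT P).
exact: mulr1.
Qed.

Lemma expectation_at_time f n : level_bounded f ->
  (\int[P]_w (at_time phi U LR LS f n w)%:E = (mean_at f n)%:E)%E.
Proof.
move=> bf; rewrite /mean_at /Rintegral fineK//.
exact/integrable_fin_num/integrable_at_time.
Qed.

(* Adding a constant makes [f] nonnegative on the levels [n] and [n + 1],
   and preserves harmonicity since [r] and [s] are probability vectors. *)
Lemma mean_at_harmonicS f n : level_bounded f -> is_harmonic r s f ->
  mean_at f n.+1 = mean_at f n.
Proof.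
move=> bf hf; have [K fK] := bf n.+1.
have bK := level_bounded_cst K.
suff : mean_at (fun a b => f a b + K) n.+1 = mean_at (fun a b => f a b + K) n.
  by rewrite !mean_atD// !mean_at_cst => /addIr.
apply: EFin_inj; rewrite -!expectation_at_time; [|exact: level_boundedD..].
(* Conditionally on the decision and the histories recorded in [X], the next label has law [q]; [g]
   is the shifted value after reading it. *)
pose q (t : bool * (seq nat * seq nat)) i := if t.1 then r i else s i.
pose g (t : bool * (seq nat * seq nat)) i :=
  (if t.1 then f (rcons t.2.1 i) t.2.2 else f t.2.1 (rcons t.2.2 i)) + K.
pose X w := (decision phi U LR LS n w,
  (R_hist phi U LR LS n w, S_hist phi U LR LS n w)).
have mX : discrete_rv X.
  apply: discrete_rv_pair; first exact: discrete_rv_decision.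
  by apply: discrete_rv_pair;
    [exact: discrete_rv_R_hist|exact: discrete_rv_S_hist].
have := @ge0_integral_independent_label _ _ _ P _ X
  (next_label phi U LR LS n) q g (fun t => f t.2.1 t.2.2 + K) mX.
rewrite (_ : (\int[P]_w (at_time phi U LR LS _ n.+1 w)%:E)%E =
  (\int[P]_w (g (X w) (next_label phi U LR LS n w))%:E)%E); last first.
  apply: eq_integral => w _; rewrite /at_time R_histS S_histS /g /=.
  by case: decision.
apply.
- exact: discrete_rv_next_label.
- by move=> t i; rewrite (next_label_independent mphi indep).
- by move=> t i; rewrite /q; case: ifP.
- move=> w i; rewrite /g /= -lerBlDr sub0r.
  have size_next := size_histsD phi U LR LS n w.
  by case: decision; apply: (le_trans _ (lerNnormlW _)); rewrite ?lerN2 ?fK//;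
    rewrite size_rcons ?addSn ?addnS size_next.
- move=> w; rewrite /q /g /=.
  have [fr fs] := hf (R_hist phi U LR LS n w) (S_hist phi U LR LS n w).
  case: decision.
  + have := sums_toD fr (sums_toZ K r1); rewrite mulr1.
    by apply: eq_sums_to => i; ring.
  + have := sums_toD fs (sums_toZ K s1); rewrite mulr1.
    by apply: eq_sums_to => i; ring.
Qed.

Lemma mean_at_centred_harmonic f n : centred_harmonic r s f ->
  mean_at f n = 0.
Proof.
move=> [f0 bf hf]; elim: n => [|n IHn]; last by rewrite mean_at_harmonicS.
by rewrite -f0 -[RHS](mean_at_cst _ 0).
Qed.

(** Since [h] has mean 0, a pointwise comparison up to a constant bounds the mean of [f]. Estimating
    a mean thus reduces to finding a suitable [h]. *)
Lemma mean_at_le f h K n : level_bounded f -> centred_harmonic r s h ->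
  (forall w, at_time phi U LR LS f n w <= at_time phi U LR LS h n w + K) -> mean_at f n <= K.
Proof.
move=> bf hh fhK; have [_ bh _] := hh; have bK := level_bounded_cst K.
have -> : K = mean_at (fun a b => h a b + K) n.
  by rewrite mean_atD// mean_at_centred_harmonic// add0r mean_at_cst.
by apply: le_Rintegral => //; apply: integrable_at_time => //;
  exact: level_boundedD.
Qed.

Lemma mean_at_ge f h K n : level_bounded f -> centred_harmonic r s h ->
  (forall w, at_time phi U LR LS h n w - K <= at_time phi U LR LS f n w) -> - K <= mean_at f n.
Proof.
move=> bf hh hKf; rewrite lerNl -mulN1r -mean_atZ//.
apply: (mean_at_le (h := fun a b => -1 * h a b)).
- by apply: level_boundedM => //; exact: level_bounded_cst.
- exact: centred_harmonicZ.
- by move=> w; have := hKf w; rewrite /at_time; lra.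
Qed.

End mean_at.
Arguments mean_at {R d dT Omega T} P phi U LR LS f n.

(** * Scores, matches and the greedy rule *)

Lemma Gamma_score {R : realType} {Omega : Type} (L : nat -> Omega -> nat)
  (q : nat -> R) m w : Gamma L q m w = score q (hist L m w).
Proof. by rewrite /Gamma /score big_map /index_iota subn1. Qed.

Lemma Matches_at_time {Omega T : Type} (phi : nat -> T -> seq nat -> seq nat -> bool)
    (U : Omega -> T) (LR LS : nat -> Omega -> nat) n w :
  Matches phi U LR LS n w =
  matches (R_hist phi U LR LS n w) (S_hist phi U LR LS n w).
Proof. exact: dotN_matches. Qed.

Definition score_gap {R : realType} (r s : nat -> R) (a b : seq nat) : R :=
  score s a - score r b.

(** The greedy rule reads from the side whose score is not the larger one, and this raises that
    score by an amount in [0, 1]; a gap in [-1, 1] therefore stays there. *)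
Lemma greedy_score_gap {R : realType} {Omega T : Type}
    (phi : nat -> T -> seq nat -> seq nat -> bool) (U : Omega -> T)
    (LR LS : nat -> Omega -> nat) (r s : nat -> R) n w :
  (forall i, 0 <= r i <= 1) -> (forall i, 0 <= s i <= 1) ->
  (forall n w, (1 <= n)%N ->
     let Rn := Rcount phi U LR LS n w in
     (Gamma LR s Rn w < Gamma LS r (n - Rn) w -> Cread phi U LR LS n.+1 w = true) /\
     (Gamma LS r (n - Rn) w < Gamma LR s Rn w -> Cread phi U LR LS n.+1 w = false)) ->
  `|at_time phi U LR LS (score_gap r s) n w| <= 1.
Proof.
move=> r01 s01 greedy; rewrite /at_time /score_gap.
elim: n => [|n IHn]; first by rewrite /score !big_nil subrr normr0.
set a := R_hist phi U LR LS n w in IHn; set b := S_hist phi U LR LS n w in IHn.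
have [tt ff] : (score s a < score r b -> decision phi U LR LS n w = true) /\
    (score r b < score s a -> decision phi U LR LS n w = false).
  (* The rule is imposed from time 1 on; at time 0 both scores are 0 and neither strict inequality
     holds. *)
  case: n @a @b IHn => [|n] a b _.
    by rewrite /score /a /b !big_nil ltxx.
  by have := greedy n.+1 w isT; rewrite /= !Gamma_score.
rewrite R_histS S_histS -/a -/b.
set i := next_label _ _ _ _ _ _; have /andP[ri0 ri1] := r01 i.
have /andP[si0 si1] := s01 i; move: IHn tt ff.
rewrite !ler_norml => /andP[IH1 IH2].
case: decision; rewrite score_rcons => tt ff.
- have : score s a <= score r b by rewrite leNgt; apply/negP => /ff.
  by move=> ab; apply/andP; split; lra.
- have : score r b <= score s a by rewrite leNgt; apply/negP => /tt.
  by move=> ab; apply/andP; split; lra.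
Qed.

(** * From an error of order sqrt n to the limit *)

Lemma cvg_div_of_dist_sqrt {R : realType} (u : nat -> R) (m c C : R) :
  0 < m -> 0 <= C ->
  (forall n, (0 < n)%N -> `|m * u n - c * n%:R| <= C * Num.sqrt n%:R) ->
  (fun n => u n * n%:R^-1) @ \oo --> c / m.
Proof.
move=> m0 C0 uC; apply/cvgrPdist_le => e e0.
near=> n.
have n0 : (0 < n)%N by near: n; exact: nbhs_infty_gt.
have nR : 0 < n%:R :> R by rewrite ltr0n.
have t0 : 0 <= Num.sqrt n%:R :> R := sqrtr_ge0 _.
have tn : Num.sqrt n%:R * Num.sqrt n%:R = n%:R :> R by rewrite -expr2 sqr_sqrtr ?ltW.
(* This holds as soon as [n] is at least [(C / (m * e)) ^+ 2]. *)
have Ct : C <= m * e * Num.sqrt n%:R.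
  have me0 : 0 < m * e by rewrite mulr_gt0.
  have Cme : 0 <= C / (m * e) by rewrite divr_ge0// ltW.
  rewrite mulrC -ler_pdivrMr// -(ger0_norm Cme) -sqrtr_sqr.
  by rewrite ler_sqrt//; near: n; exact: nbhs_infty_ger.
have -> : c / m - u n * n%:R^-1 = - ((m * u n - c * n%:R) / (m * n%:R)).
  by field; rewrite !gt_eqF.
rewrite normrN normrM normfV (gtr0_norm (mulr_gt0 m0 nR)).
rewrite ler_pdivrMr ?mulr_gt0// (le_trans (uC n n0))//.
have -> : e * (m * n%:R) = (m * e * Num.sqrt n%:R) * Num.sqrt n%:R.
  by rewrite -[RHS]mulrA tn; ring.
exact: ler_wpM2r.
Unshelve. all: by end_near. Qed.

(** * Mean match counts under the two kinds of policy *)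

Section mean_matches.
Context {R : realType} {d dT : measure_display} {Omega : measurableType d}
  {T : measurableType dT} {P : probability Omega R}
  {phi : nat -> T -> seq nat -> seq nat -> bool}
  {U : Omega -> T} {LR LS : nat -> Omega -> nat}
  {r s : nat -> R} {mu sigR2 sigS2 : R}.
Hypothesis mphi : forall n a b, measurable [set u | phi n u a b].
Hypothesis mU : measurable_fun setT U.
Hypothesis mLR : forall j, discrete_rv (LR j).
Hypothesis mLS : forall j, discrete_rv (LS j).
Hypothesis indep : forall (A : set T), measurable A -> forall (a b : seq nat),
  P (U @^-1` A `&` [set w | hist LR (size a) w = a]
              `&` [set w | hist LS (size b) w = b])
  = (P (U @^-1` A) * (\prod_(x <- a) r x * \prod_(y <- b) s y)%:E)%E.
Hypothesis r01 : forall i, 0 <= r i <= 1.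
Hypothesis s01 : forall i, 0 <= s i <= 1.
Hypothesis r1 : sums_to r 1.
Hypothesis s1 : sums_to s 1.
Hypothesis rsmu : sums_to (fun i => r i * s i) mu.
Hypothesis mu0 : 0 < mu.
Hypothesis rsig : sums_to (fun i => r i * (s i - mu) ^+ 2) sigR2.
Hypothesis ssig : sums_to (fun i => s i * (r i - mu) ^+ 2) sigS2.

Let nmatches (a b : seq nat) : R := (matches a b)%:R.
Let r0 i : 0 <= r i. Proof. by have /andP[] := r01 i. Qed.
Let s0 i : 0 <= s i. Proof. by have /andP[] := s01 i. Qed.
Let sigR20 : 0 <= sigR2.
Proof. by apply: ge0_sums_to rsig => i; rewrite mulr_ge0// sqr_ge0. Qed.
Let sigS20 : 0 <= sigS2.
Proof. by apply: ge0_sums_to ssig => i; rewrite mulr_ge0// sqr_ge0. Qed.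

Let size_hists n w : n%:R = (size (R_hist phi U LR LS n w))%:R
  + (size (S_hist phi U LR LS n w))%:R :> R.
Proof. by rewrite -natrD size_histsD. Qed.

(* With [Z = A + B - mu n], where [A] and [B] are the two scores at time [n],
   [4 A B + (A - B)^2 = (Z + mu n)^2]. *)
Let base (n : nat) (a b : seq nat) : R :=
  4 * (mu * (matches a b)%:R - score s a * score r b)
  + ((centred_score r s mu 1 a b ^+ 2
      - (sigR2 * (size a)%:R + sigS2 * (size b)%:R))
     + 2 * mu * n%:R * centred_score r s mu 1 a b).

Let centred_harmonic_base n : centred_harmonic r s (base n).
Proof.
apply: centred_harmonicD; first apply: centred_harmonicZ.
  exact: centred_harmonic_matches.
apply: centred_harmonicD.
  by apply: centred_harmonic_score_sqr => //; rewrite expr1n.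
by apply: centred_harmonicZ; exact: (centred_harmonic_score r01 s01 r1 s1 rsmu rsig ssig).
Qed.

Let baseE n w : at_time phi U LR LS (base n) n w =
  4 * mu * at_time phi U LR LS nmatches n w - mu ^+ 2 * n%:R ^+ 2
  + at_time phi U LR LS (score_gap r s) n w ^+ 2
  - (sigR2 * (size (R_hist phi U LR LS n w))%:R
     + sigS2 * (size (S_hist phi U LR LS n w))%:R).
Proof.
rewrite /at_time /base /nmatches /centred_score /score_gap (size_hists n w).
by ring.
Qed.

Let shifted c (a b : seq nat) : R := 4 * mu * nmatches a b + c.

Let level_bounded_shifted c : level_bounded (shifted c).
Proof.
apply: level_boundedD; last exact: level_bounded_cst.
apply: level_boundedM; first exact: level_bounded_cst.
exact: level_bounded_matches.
Qed.

Let mean_at_shifted c n : mean_at P phi U LR LS (shifted c) n =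
  4 * mu * mean_at P phi U LR LS nmatches n + c.
Proof.
have bm : level_bounded nmatches by exact: level_bounded_matches.
rewrite mean_atD// ?mean_atZ// ?mean_at_cst//; last exact: level_bounded_cst.
by apply: level_boundedM => //; exact: level_bounded_cst.
Qed.

(** With p and q the history sizes, [sigR2] p + [sigS2] q is [(sigR2 + sigS2) / 2] times n plus
    [(sigR2 - sigS2) / 2] times p - q. A multiple of the centred score difference trades p - q for
    the gap over [mu], which is bounded. *)
Lemma mean_matches_gap_le1 n :
  (forall w, `|at_time phi U LR LS (score_gap r s) n w| <= 1) ->
  `|4 * mu * mean_at P phi U LR LS nmatches n
    - (mu ^+ 2 * n%:R ^+ 2 + (sigR2 + sigS2) / 2 * n%:R)|
  <= `|sigR2 - sigS2| / (2 * mu) + 1.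
Proof.
(* Chosen so that [k * mu] is [(sigR2 - sigS2) / 2], the coefficient of p - q to be cancelled. *)
move=> gap1; pose k := (sigR2 - sigS2) / (2 * mu).
have kE : 2 * mu * k = sigR2 - sigS2 by rewrite /k; field; rewrite gt_eqF.
have kN : `|sigR2 - sigS2| / (2 * mu) = `|k|.
  by rewrite normrM normfV (gtr0_norm (x := 2 * mu))// mulr_gt0.
rewrite kN -mean_at_shifted.
set c := - _; pose h a b := base n a b + - k * centred_score r s mu (-1) a b.
have hh : centred_harmonic r s h.
  apply: centred_harmonicD => //; apply: centred_harmonicZ.
  exact: (centred_harmonic_score r01 s01 r1 s1 rsmu rsig ssig).
have hE w : at_time phi U LR LS (shifted c) n w = at_time phi U LR LS h n w
    + (k * at_time phi U LR LS (score_gap r s) n w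
       - at_time phi U LR LS (score_gap r s) n w ^+ 2).
  rewrite {2}/at_time /h -[base n _ _]/(at_time phi U LR LS (base n) n w) baseE.
  have sigE : sigR2 = sigS2 + 2 * mu * k by rewrite kE; ring.
  rewrite /at_time /shifted /c /score_gap /centred_score sigE (size_hists n w).
  by field.
have errB w : `|k * at_time phi U LR LS (score_gap r s) n w
       - at_time phi U LR LS (score_gap r s) n w ^+ 2| <= `|k| + 1.
  rewrite (le_trans (ler_normB _ _))// lerD//.
    by rewrite normrM ler_piMr.
  by rewrite normrX expr_le1.
rewrite ler_norml; apply/andP; split.
- apply: (mean_at_ge mphi mU mLR mLS indep r0 s0 r1 s1 _ hh) => // w.
  by rewrite hE lerD2l; have := errB w; rewrite ler_norml => /andP[].
- apply: (mean_at_le mphi mU mLR mLS indep r0 s0 r1 s1 _ hh) => // w.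
  by rewrite hE lerD2l; have := errB w; rewrite ler_norml => /andP[].
Qed.

(** The gap is [y + mu * Q] with [Q] bounded by 1. In its square, [y ^+ 2] has the same mean as the
    variance term of [base], and the cross term is controlled pathwise by the AM-GM inequality and a
    harmonic correction. *)
Lemma mean_matches_balanced n : (0 < n)%N ->
  (forall w, `|(size (R_hist phi U LR LS n w))%:R
    - (size (S_hist phi U LR LS n w))%:R| <= 1 :> R) ->
  `|4 * mu * mean_at P phi U LR LS nmatches n - mu ^+ 2 * n%:R ^+ 2|
  <= mu * (sigR2 + sigS2 + 1) * Num.sqrt n%:R + mu ^+ 2.
Proof.
move=> n0 Q1; rewrite -mean_at_shifted; set c := - _.
set t : R := Num.sqrt n%:R.
have t0 : 0 < t by rewrite sqrtr_gt0 ltr0n.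
have tt : t ^+ 2 = n%:R by rewrite sqr_sqrtr.
pose y2 (a b : seq nat) : R := centred_score r s mu (-1) a b ^+ 2
    - (sigR2 * (size a)%:R + sigS2 * (size b)%:R).
have hy2 : centred_harmonic r s y2.
  by apply: centred_harmonic_score_sqr => //; rewrite sqrrN expr1n.
(* The coefficient -1 cancels [y ^+ 2 - v] inside [base]; the part [e * (mu / t)] supplies the
   square that dominates the cross term, with [e = 1] for the upper bound and [e = -1] for the lower
   one. *)
pose h e a b := base n a b + (-1 + e * (mu / t)) * y2 a b.
have hh e : centred_harmonic r s (h e).
  by apply: centred_harmonicD => //; exact: centred_harmonicZ.
pose y w := at_time phi U LR LS (centred_score r s mu (-1)) n w.
pose Q w : R := (size (R_hist phi U LR LS n w))%:R
    - (size (S_hist phi U LR LS n w))%:R.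
pose v w : R := sigR2 * (size (R_hist phi U LR LS n w))%:R
     + sigS2 * (size (S_hist phi U LR LS n w))%:R.
have hE e w : at_time phi U LR LS (shifted c) n w = at_time phi U LR LS (h e) n w
    + (- (2 * mu * y w * Q w + mu ^+ 2 * Q w ^+ 2) - e * (mu / t * (y w ^+ 2 - v w))).
  rewrite {2}/at_time /h -[base n _ _]/(at_time phi U LR LS (base n) n w) baseE.
  rewrite /at_time /shifted /c /y2 /y /v /Q /at_time /score_gap /centred_score.
  rewrite (size_hists n w).
  by ring.
have Qw w : `|Q w| <= 1 by exact: Q1.
have errB w : `|2 * mu * y w * Q w + mu ^+ 2 * Q w ^+ 2| <=
    mu / t * (y w ^+ 2 - v w) + (mu * (sigR2 + sigS2 + 1) * t + mu ^+ 2).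
  have vn : v w <= (sigR2 + sigS2) * t ^+ 2.
    rewrite tt (size_hists n w) /v.
    by rewrite mulrDl lerD// ler_wpM2l// ?lerDl ?lerDr ler0n.
  (* AM-GM at the scale [t] of the fluctuations of [y]: after multiplication by [t], the difference
     of the two sides is a square. *)
  have AG : 2 * `|y w| <= y w ^+ 2 / t + t.
    rewrite -(ler_pM2r t0) [leRHS]mulrDl divfK ?gt_eqF// -subr_ge0.
    rewrite -[y w ^+ 2]real_normK ?num_real//.
    rewrite (_ : _ - _ = (`|y w| - t) ^+ 2) ?sqr_ge0//; by ring.
  apply: (@le_trans _ _ (mu * (2 * `|y w|) + mu ^+ 2)).
    rewrite (le_trans (ler_normD _ _))// lerD//.
      rewrite !normrM (gtr0_norm mu0) (ger0_norm (x := 2))//.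
      rewrite (_ : 2 * mu * _ * _ = mu * (2 * `|y w|) * `|Q w|); last by ring.
      by rewrite ler_piMr// ?Qw// !mulr_ge0// ltW.
    rewrite normrM !normrX (gtr0_norm mu0) ler_piMr ?sqr_ge0//.
    by rewrite expr_le1// Qw.
  rewrite addrA lerD2r.
  apply: (@le_trans _ _ (mu * (y w ^+ 2 / t + t))).
    by rewrite ler_wpM2l// ltW.
  rewrite -subr_ge0.
  rewrite (_ : _ - _ = mu / t * ((sigR2 + sigS2) * t ^+ 2 - v w)).
    by rewrite mulr_ge0 ?divr_ge0 ?subr_ge0// ltW.
  by field; rewrite gt_eqF.
rewrite ler_norml; apply/andP; split.
- apply: (mean_at_ge mphi mU mLR mLS indep r0 s0 r1 s1 _ (hh (-1))) => // w.
  rewrite (hE (-1)) lerD2l; have := errB w; rewrite ler_norml => /andP[].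
  by set p := mu / t * _; lra.
- apply: (mean_at_le mphi mU mLR mLS indep r0 s0 r1 s1 _ (hh 1)) => // w.
  rewrite (hE 1) lerD2l; have := errB w; rewrite ler_norml => /andP[].
  by set p := mu / t * _; lra.
Qed.

End mean_matches.

(** * The alternating policy and the limit *)

Lemma alternating_balanced {R : realType} {Omega T : Type}
    (phi : nat -> T -> seq nat -> seq nat -> bool) (U : Omega -> T)
    (LR LS : nat -> Omega -> nat) n w :
  (forall n w, Rcount phi U LR LS (2 * n) w = n) ->
  `|(size (R_hist phi U LR LS n w))%:R
    - (size (S_hist phi U LR LS n w))%:R| <= 1 :> R.
Proof.
(* Even times are exactly balanced; an odd time comes one reading after an even one, so the
   difference is 1 or -1. *)
move=> alt; rewrite !size_hist -[n]odd_double_half -mul2n.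
case: (odd n); last by rewrite add0n alt mulSn mul1n addnK subrr normr0.
rewrite add1n RcountS alt.
case: decision; last by rewrite addn0 mulSn mul1n -addSn addnK -natr1 opprD addNKr normrN1.
by rewrite addn1 mulSn mul1n -addSn addKn -natr1 addrAC subrr add0r normr1.
Qed.

Theorem theorem4p1
  (R : realType) (d : measure_display) (Omega : measurableType d)
  (P : probability Omega R)
  (r s : nat -> R) (mu sigR2 sigS2 : R)
  (LR LS : nat -> Omega -> nat)
  (dT : measure_display) (T : measurableType dT) (U : Omega -> T)
  (phiG : nat -> T -> seq nat -> seq nat -> bool)
  (psiA : nat -> T -> bool) :
  (* probability vectors on the positive integers *)
  (forall i, 0 <= r i) -> r 0 = 0 -> sums_to r 1 ->
  (forall i, 0 <= s i) -> s 0 = 0 -> sums_to s 1 ->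
  (* mu = sum_i r_i s_i > 0 *)
  sums_to (fun i => r i * s i) mu -> 0 < mu ->
  (* variances of X_R = s_{L_R}, X_S = r_{L_S} (both with mean mu) *)
  sums_to (fun i => r i * (s i - mu) ^+ 2) sigR2 ->
  sums_to (fun i => s i * (r i - mu) ^+ 2) sigS2 ->
  (* standing assumption sigma_R + sigma_S > 0 *)
  0 < Num.sqrt sigR2 + Num.sqrt sigS2 ->
  (* measurability of labels and of the randomization *)
  (forall j i, measurable [set w | LR j w = i]) ->
  (forall j i, measurable [set w | LS j w = i]) ->
  measurable_fun setT U ->
  (* L_R(1), L_R(2), ... i.i.d. ~ r ; L_S(1), ... i.i.d. ~ s ; the two
     sequences and F_0 = sigma(U) mutually independent *)
  (forall (A : set T), measurable A -> forall (a b : seq nat),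
     P (U @^-1` A `&` [set w | hist LR (size a) w = a]
                 `&` [set w | hist LS (size b) w = b])
     = (P (U @^-1` A) * (\prod_(x <- a) r x * \prod_(y <- b) s y)%:E)%E) ->
  (* the decision rules are F_n-measurable *)
  (forall n a b, measurable [set u | phiG n u a b]) ->
  (forall n, measurable [set u | psiA n u]) ->
  (* the policy phiG is greedy *)
  (forall n w, (1 <= n)%N ->
     let Rn := Rcount phiG U LR LS n w in
     (Gamma LR s Rn w < Gamma LS r (n - Rn) w -> Cread phiG U LR LS n.+1 w = true) /\
     (Gamma LS r (n - Rn) w < Gamma LR s Rn w -> Cread phiG U LR LS n.+1 w = false)) ->
  (* the policy psiA (F_0-measurable) is alternating: R(2n) = n *)
  (forall n w, Rcount (fun k u _ _ => psiA k u) U LR LS (2 * n) w = n) ->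
  (fun n : nat =>
     ('E_P[fun w => ((Matches phiG U LR LS n w)%:R
                    - (Matches (fun k u _ _ => psiA k u) U LR LS n w)%:R : R)%R]
      * ((n%:R)^-1)%:E)%E)
    @ \oo --> ((sigR2 + sigS2) / (8 * mu))%:E.
Proof.
move=> r0 _ r1 s0 _ s1 rsmu mu0 rsig ssig _ mLR mLS mU indep mG mA greedy alt.
have r01 i : 0 <= r i <= 1 by rewrite r0 (ge0_sums_to_le i r0 r1).
have s01 i : 0 <= s i <= 1 by rewrite s0 (ge0_sums_to_le i s0 s1).
have sigR20 : 0 <= sigR2.
  by apply: ge0_sums_to rsig => i; rewrite mulr_ge0// sqr_ge0.
have sigS20 : 0 <= sigS2.
  by apply: ge0_sums_to ssig => i; rewrite mulr_ge0// sqr_ge0.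
(* The alternating rule is a decision rule that ignores both histories, so the estimates for general
   policies apply to it. *)
set phiA := fun k u _ _ => psiA k u in alt *.
have {}mA n (a b : seq nat) : measurable [set u | phiA n u a b] := mA n.
pose nmatches (a b : seq nat) : R := (matches a b)%:R.
pose mG' n := mean_at P phiG U LR LS nmatches n.
pose mA' n := mean_at P phiA U LR LS nmatches n.
have bm : level_bounded nmatches by exact: level_bounded_matches.
have expE n : ('E_P[fun w => ((Matches phiG U LR LS n w)%:R
    - (Matches phiA U LR LS n w)%:R : R)%R] * ((n%:R)^-1)%:E =
    ((mG' n - mA' n) * n%:R^-1)%:E)%E.
  rewrite EFinM EFinB -!expectation_at_time// unlock -integralB_EFin//.
  - by congr (_ * _)%E; apply: eq_integral => w _; rewrite !Matches_at_time.
  - exact: integrable_at_time.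
  - exact: integrable_at_time.
under eq_fun do rewrite expE.
apply: cvg_EFin; first exact: nearW.
(* Both estimates concern [4 * mu] times a mean, and [(sigR2 + sigS2) / 2] is the difference of
   their linear coefficients. *)
have -> : (sigR2 + sigS2) / (8 * mu) = ((sigR2 + sigS2) / 2) / (4 * mu).
  by field; rewrite gt_eqF.
(* [C1] gathers the bounded errors of both policies and [C2] is the coefficient of the square root;
   since the root is at least 1, [C1 + C2] works. The quadratic terms cancel in the difference. *)
pose C1 := `|sigR2 - sigS2| / (2 * mu) + 1 + mu ^+ 2.
pose C2 := mu * (sigR2 + sigS2 + 1).
have C10 : 0 <= C1 by rewrite !addr_ge0 ?sqr_ge0// divr_ge0// mulr_ge0// ltW.
have C20 : 0 <= C2 by rewrite mulr_ge0 ?ltW// ltr_wpDl ?addr_ge0.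
apply: (@cvg_div_of_dist_sqrt _ _ _ _ (C1 + C2)); first by rewrite mulr_gt0.
  exact: addr_ge0.
move=> n n0.
have hG := mean_matches_gap_le1 mG mU mLR mLS indep r01 s01 r1 s1 rsmu mu0 rsig
  ssig (fun w => greedy_score_gap n w r01 s01 greedy).
have hA := mean_matches_balanced mA mU mLR mLS indep r01 s01 r1 s1 rsmu mu0 rsig
  ssig n0 (fun w => alternating_balanced n w alt).
have sqrt1 : 1 <= Num.sqrt n%:R :> R by rewrite -[leLHS]sqrtr1 ler_sqrt// ler1n.
have C1n : `|sigR2 - sigS2| / (2 * mu) + 1 + mu ^+ 2 <= C1 * Num.sqrt n%:R.
  by rewrite -/C1 ler_peMr.
move: hG hA; rewrite -/(mG' n) -/(mA' n) -/C2 !ler_norml.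
move=> /andP[hG1 hG2] /andP[hA1 hA2].
move: C1n hG1 hG2 hA1 hA2; move: C2 C1 (_ / (2 * mu)) {C10 C20} => C2 C1 x C1n hG1 hG2 hA1 hA2.
by apply/andP; split; lra.
Qed.
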